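(* For all integers $n,k\ge0$, the coefficient $g_{n+k,n}$ of $x^n$ in $\hat p_{n+k}(x)$ is $$g_{n+k,n}=\sum_{a+b=k}\ \sum_{\substack{A\subseteq\{0,\dots,n+a-1\}\\|A|=a}}\ \sum_{\substack{B\subseteq\{0,\dots,n+a+b-1\}\\|B|=b}} w_n(A,B),$$ where the outer sum is over pairs of nonnegative integers $(a,b)$ with $a+b=k$.
   Context: Let $\alpha,\beta,\epsilon_1,\epsilon_2,q$ be indeterminates and $[i]_q=1+q+\cdots+q^{i-1}$ for $i\ge0$ ($[0]_q=0$). Empty products equal $1$. The transformed Al-Salam-Chihara polynomials $(\hat p_n(x))_{n\ge0}$ are defined by $\hat p_{-1}(x)=0$, $\hat p_0(x)=1$ and, for $n\ge0$, $\hat p_{n+1}(x)=(x+b_n)\hat p_n(x)-\lambda_n\hat p_{n-1}(x)$, where $b_n=(\alpha+\beta)q^n+(\epsilon_1+\epsilon_2)[n]_q$ and $\lambda_n=\epsilon_1\epsilon_2[n]_q[n-1]_q+(\alpha\epsilon_2+\beta\epsilon_1)q^{n-1}[n]_q+\alpha\beta(q^{2n-1}-q^{n-1})$ (for $n\ge1$; $\lambda_0$ plays no role). For $i\ge0$ put $X_i=\alpha q^i+\epsilon_1[i]_q$ and $Y_i=\beta q^i+\epsilon_2[i]_q$. For a finite set $S$ of nonnegative integers and $k\ge1$, $S(k)$ denotes the $k$-th smallest element of $\{0,1,2,\dots\}\setminus S$. If $S=\{i_1<\cdots<i_s\}$, put $\lambda_S=(i_1,i_2-1,\dots,i_s-s+1)$.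 For $A=\{i_1<\cdots<i_a\}\subseteq\{0,\dots,n+a-1\}$ and $B\subseteq\{0,\dots,n+a+b-1\}$ with $|B|=b$, write $B\cap\{n+b,\dots,n+b+a-1\}=\{n+b+a-j_k<\cdots<n+b+a-j_1\}$ (here $k$ is the size of this intersection, so $1\le j_1<\cdots<j_k\le a$) and $\mu=\lambda_A=(\mu_1,\dots,\mu_a)$. The weight is $$w_n(A,B)=\Big(\prod_{i\in A}X_i\Big)\Big(\prod_{i\in B\cap\{0,\dots,n+b-1\}}Y_i\Big)\prod_{l=1}^{k}\Big(q^{(n+b+a-j_l)-B(\mu_{j_l}+l)}\,Y_{B(\mu_{j_l}+l)}\Big).$$ *)

(* Defs.v *)
From mathcomp Require Import all_boot all_order all_algebra.

Set Implicit Arguments.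
Unset Strict Implicit.
Unset Printing Implicit Defensive.

Import GRing.Theory.
Local Open Scope ring_scope.

(* The indeterminates alpha, beta, eps1, eps2, q are rendered as elements
   al be e1 e2 q of a commutative ring R; taking for R a polynomial ring and for
   these elements its variables gives genuine indeterminates. *)

Definition qint (R : comNzRingType) (q : R) (i : nat) : R :=
  \sum_(j < i) q ^+ j.

Definition asc_b (R : comNzRingType) (al be e1 e2 q : R) (n : nat) : R :=
  (al + be) * q ^+ n + (e1 + e2) * qint q n.

(* Only meaningful for n >= 1, because of the natural-number exponents. *)
Definition asc_lambda (R : comNzRingType) (al be e1 e2 q : R) (n : nat) : R :=
  e1 * e2 * qint q n * qint q (n - 1)
  + (al * e2 + be * e1) * q ^+ (n - 1) * qint q n
  + al * be * (q ^+ (2 * n - 1) - q ^+ (n - 1)).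

(* The inner match is the convention p_{-1} = 0, which also makes
   asc_lambda ... 0 irrelevant. *)
Fixpoint asc_poly (R : comNzRingType) (al be e1 e2 q : R) (n : nat) : {poly R} :=
  match n with
  | 0 => 1
  | m.+1 =>
      ('X + (asc_b al be e1 e2 q m)%:P) * asc_poly al be e1 e2 q m
      - (asc_lambda al be e1 e2 q m)%:P
        * match m with
          | 0 => 0
          | l.+1 => asc_poly al be e1 e2 q l
          end
  end.

Definition wtX (R : comNzRingType) (al e1 q : R) (i : nat) : R :=
  al * q ^+ i + e1 * qint q i.

Definition wtY (R : comNzRingType) (be e2 q : R) (i : nat) : R :=
  be * q ^+ i + e2 * qint q i.

(* A finite set of naturals contained in {0, ..., m-1} is a {set 'I_m}.  As
   enum 'I_m is increasing, so is this list of elements. *)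
Definition elts (m : nat) (S : {set 'I_m}) : seq nat :=
  [seq val i | i <- enum S].

(* S(k), the k-th smallest element of nat \ S, for k >= 1.  At least k elements
   of {0, ..., m+k-1} lie outside S, so scanning that range suffices. *)
Definition kth_missing (m : nat) (S : {set 'I_m}) (k : nat) : nat :=
  nth 0%N [seq i <- iota 0 (m + k) | i \notin elts S] (k - 1)%N.

(* (i_1, i_2 - 1, ..., i_s - s + 1) for S = {i_1 < ... < i_s}; the list index j
   starts from 0. *)
Definition lambda_set (m : nat) (S : {set 'I_m}) : seq nat :=
  mkseq (fun j => nth 0 (elts S) j - j)%N #|S|.

(* The increasing list (j_1, ..., j_k) of those j in {1, ..., a} with
   n+b+a-j in B. *)
Definition top_indices (n a b : nat) (B : {set 'I_(n + a + b)}) : seq nat :=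
  [seq j <- iota 1 a | (n + b + a - j)%N \in elts B].

(* Entries of mu and of js are numbered from 1 in the mathematics and from 0 by
   nth.  When #|A| = a and #|B| = b, one has
   kth_missing B (mu_{j_l} + l) <= n + b + a - j_l, so that the subtraction in
   the exponent of q is not truncated. *)
Definition weight (R : comNzRingType) (al be e1 e2 q : R) (n a b : nat)
    (A : {set 'I_(n + a)}) (B : {set 'I_(n + a + b)}) : R :=
  let mu := lambda_set A in
  let js := top_indices B in
  (\prod_(i in A) wtX al e1 q i)
  * (\prod_(i in B | (i < n + b)%N) wtY be e2 q i)
  * \prod_(1 <= l < (size js).+1)
      (let j := nth 0%N js (l - 1)%N in
       let c := kth_missing B (nth 0%N mu (j - 1) + l)%N in
       q ^+ (n + b + a - j - c)%N * wtY be e2 q c).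

(* Main.v *)
(* Writing p_N(al, be) for the polynomial of degree N, both sides of the theorem
   are governed by the recurrence
     p_N(al, be) = x p_{N-1}(X_1, Y_1) + al p_{N-1}(X_1, be) + be p_{N-1}(al, Y_1)
                   - (1 - q^(N-1)) al be p_{N-2}(X_1, Y_1),
   in which the parameters are shifted by X_i(X_1) = X_{i+1}, Y_i(Y_1) = Y_{i+1}.
   For the polynomials it follows from
     p_N(al, be) = p_N(X_1, be) - (e1 - (1 - q) al) [N]_q p_{N-1}(X_1, be)
   and its mirror image.  On the combinatorial side, the indices c_l = B(mu_{j_l} + l)
   always lie below n + b, so B splits into a word v of length n + b and a marking J
   of the elements of A, and the weight is a product over the letters of the words of
   A and v.  Removing first letters, one meets an unmarked element of A (factor al),
   or an element of B below n + b (factor be), or both (counted twice, hence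
   subtracted), or a marked element of A together with c_1 = 0 (factor
   q^(N-1) al be), or a non-element in both words (which lowers n). *)

Require Import Defs.
From mathcomp Require Import all_boot all_order all_algebra.
From mathcomp Require Import ring zify.

Set Implicit Arguments.
Unset Strict Implicit.
Unset Printing Implicit Defensive.

Import GRing.Theory.
Local Open Scope ring_scope.

(** * Contiguous relations for the polynomials *)

Section Poly.
Context (R : comNzRingType) (e1 e2 q : R).
Implicit Types al be : R.

Local Notation X al := (wtX al e1 q).
Local Notation Y be := (wtY be e2 q).

Lemma qintS n : qint q n.+1 = 1 + q * qint q n.
Proof.
rewrite /qint big_ord_recl expr0 mulr_sumr; congr (_ + _).
by apply: eq_bigr => i _; rewrite exprS.
Qed.

Lemma qint0 : qint q 0 = 0.
Proof. by rewrite /qint big_ord0. Qed.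

(** Trading powers of [q] for $[n]_q$ turns the later identities into polynomial ones that [ring]
    settles without dividing by $1-q$. *)
Lemma qint_exp n : q ^+ n = 1 - (1 - q) * qint q n.
Proof.
elim: n => [|n IH]; first by rewrite expr0 qint0 mulr0 subr0.
by rewrite exprS qintS IH; ring.
Qed.

Lemma wtX0 al : X al 0 = al.
Proof. by rewrite /wtX qint0; ring. Qed.

Lemma wtX_shift al i : X (X al 1) i = X al i.+1.
Proof. by rewrite /wtX !qintS qint0 !exprS (qint_exp i); ring. Qed.

Lemma wtY0 be : Y be 0 = be.
Proof. by rewrite /wtY qint0; ring. Qed.

Lemma wtY_shift be i : Y (Y be 1) i = Y be i.+1.
Proof. by rewrite /wtY !qintS qint0 !exprS (qint_exp i); ring. Qed.

Local Notation p al be := (asc_poly al be e1 e2 q).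

Lemma asc_lambdaS al be n :
  asc_lambda al be e1 e2 q n.+1 =
  qint q n.+1 * (e1 * e2 * qint q n + (al * e2 + be * e1) * q ^+ n
                 - (1 - q) * (al * be) * q ^+ n).
Proof.
rewrite /asc_lambda subSS subn0.
have -> : (2 * n.+1 - 1 = n + n.+1)%N by lia.
by rewrite exprD (qint_exp n.+1); ring.
Qed.

Lemma asc_poly0 al be : p al be 0 = 1.
Proof. by []. Qed.

Lemma asc_poly1 al be : p al be 1 = 'X + (al + be)%:P.
Proof. by rewrite /= mulr0 subr0 mulr1 /asc_b qint0; congr ('X + _%:P); ring. Qed.

Lemma asc_polySS al be n :
  p al be n.+2 = ('X + (asc_b al be e1 e2 q n.+1)%:P) * p al be n.+1
    - (asc_lambda al be e1 e2 q n.+1)%:P * p al be n.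
Proof. by []. Qed.

(** Induction along the three-term recurrence: with the two preceding cases inserted, both sides are
    combinations of [P0] and [P1] with equal coefficients. Degrees 1 and 2 are separate since the
    relation does not cover degree 0. *)
Lemma asc_poly_shiftX al be n :
  p al be n.+1 = p (X al 1) be n.+1
    - ((e1 - (1 - q) * al) * qint q n.+1)%:P * p (X al 1) be n.
Proof.
elim/ltn_ind: n => -[|[|n]] IH.
- by rewrite !asc_poly1 asc_poly0 /wtX !qintS qint0 !(polyCM, polyCD, polyCN); ring.
- rewrite !asc_polySS IH // !asc_poly1 asc_poly0 /asc_b !asc_lambdaS /wtX !qintS qint0.
  by rewrite !(polyCM, polyCD, polyCN); ring.
rewrite asc_polySS IH // IH // !asc_polySS.
set P0 := p _ _ n; set P1 := p _ _ n.+1.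
rewrite /asc_b !asc_lambdaS /wtX !qintS qint0 !exprS (qint_exp n).
rewrite !(polyCM, polyCD, polyCN).
ring.
Qed.

End Poly.

(** This symmetry transfers the contiguous relation in [al] to one in [be]. *)
Lemma asc_polyC (R : comNzRingType) (al be e1 e2 q : R) n :
  asc_poly al be e1 e2 q n = asc_poly be al e2 e1 q n.
Proof.
elim/ltn_ind: n => -[|[|n]] IH //.
  by rewrite !asc_poly1 (addrC al).
rewrite !asc_polySS !IH // /asc_b /asc_lambda.
by rewrite (addrC al) (addrC e1) (mulrC e1) (addrC (al * e2)) (mulrC al be).
Qed.

Section PolyRec.
Context (R : comNzRingType) (e1 e2 q : R).
Implicit Types al be : R.

Local Notation X al := (wtX al e1 q).
Local Notation Y be := (wtY be e2 q).
Local Notation p al be := (asc_poly al be e1 e2 q).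

Lemma asc_poly_shiftY al be n :
  p al be n.+1 = p al (Y be 1) n.+1
    - ((e2 - (1 - q) * be) * qint q n.+1)%:P * p al (Y be 1) n.
Proof. by rewrite !(asc_polyC al); exact: asc_poly_shiftX. Qed.

Lemma asc_poly_rec al be n :
  p al be n.+2 = 'X * p (X al 1) (Y be 1) n.+1
    + al%:P * p (X al 1) be n.+1 + be%:P * p al (Y be 1) n.+1
    - ((1 - q ^+ n.+1) * (al * be))%:P * p (X al 1) (Y be 1) n.
Proof.
(* Every polynomial is moved to the parameters $(X_1, Y_1)$; the three-term recurrence then leaves
   an identity in two consecutive degrees. *)
rewrite (asc_poly_shiftX _ _ _ al be n.+1) !(asc_poly_shiftY _ be).
rewrite (asc_poly_shiftX _ _ _ al).
rewrite !asc_polySS.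
set P1 := p _ _ n.+1; set P0 := p _ _ n.
rewrite /asc_b !asc_lambdaS /wtX /wtY !qintS qint0 !exprS (qint_exp q n).
rewrite !(polyCM, polyCD, polyCN).
ring.
Qed.

End PolyRec.

(** * Words and the recurrence for the weighted sum *)

Fixpoint bitseqs m : seq bitseq :=
  if m is m'.+1 then
    [seq true :: u | u <- bitseqs m'] ++ [seq false :: u | u <- bitseqs m']
  else [:: [::]].

Lemma mem_bitseqs m (u : bitseq) : (u \in bitseqs m) = (size u == m).
Proof.
elim: m u => [|m IH] [|b u] //=; rewrite mem_cat.
  by apply/negP => /orP[] /mapP[].
rewrite eqSS -IH; apply/orP/idP => [[] /mapP[v vm [_ ->]] // | um].
by case: b; [left | right]; apply/mapP; exists u.
Qed.

Lemma bitseqs_uniq m : uniq (bitseqs m).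
Proof.
have consI b : injective (cons b : bitseq -> bitseq) by move=> u v [].
elim: m => //= m IH; rewrite cat_uniq !map_inj_uniq // IH andbT /=.
by apply/hasPn => _ /mapP[u _ ->]; apply/mapP => -[].
Qed.

Section BitseqSums.
Context (V : nmodType).
Implicit Types (P : pred bitseq) (F : bitseq -> V).

Lemma big_bitseqsS m P F :
  \sum_(u <- bitseqs m.+1 | P u) F u =
    \sum_(u <- bitseqs m | P (true :: u)) F (true :: u)
  + \sum_(u <- bitseqs m | P (false :: u)) F (false :: u).
Proof. by rewrite big_cat !big_map. Qed.

Lemma big_bitseqs_eq0 m P F :
  (forall u, size u = m -> ~~ P u) -> \sum_(u <- bitseqs m | P u) F u = 0.
Proof.
move=> nP; rewrite big_seq_cond big1 // => u.
by rewrite mem_bitseqs => /andP[/eqP /nP /negPf ->].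
Qed.

Lemma big_bitseqs_words n a F : (0 < n + a)%N ->
  \sum_(w <- bitseqs (n + a) | count id w == a) F w =
    (if a is a'.+1 then
       \sum_(w <- bitseqs (n + a') | count id w == a') F (true :: w) else 0)
  + (if n is n'.+1 then
       \sum_(w <- bitseqs (n' + a) | count id w == a) F (false :: w) else 0).
Proof.
case: n a => [|n] [|a] // _.
- rewrite add0n big_bitseqsS; congr (_ + _).
  apply: big_bitseqs_eq0 => u; move: (count_size id u) => /=; lia.
- by rewrite addSn big_bitseqsS; congr (_ + _); apply: big_bitseqs_eq0 => u /=.
- rewrite addSn big_bitseqsS addnS addSn.
  by congr (_ + _); apply: eq_bigl => u.
Qed.

End BitseqSums.

Definition trues (u : bitseq) : seq nat := mask u (iota 0 (size u)).
(** If [v] is an initial part of the indicator word of $B$, then [falses v] is the beginning of the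
    list $B(1), B(2), \ldots$ *)
Definition falses (u : bitseq) : seq nat := mask (map negb u) (iota 0 (size u)).

(* [w] is the indicator word of A and [J] has one letter per element of A, true
   when that element is marked; unmarked elements are deleted. *)
Fixpoint erase (w J : bitseq) : bitseq :=
  match w, J with
  | false :: w', _ => false :: erase w' J
  | true :: w', true :: J' => true :: erase w' J'
  | true :: w', false :: J' => erase w' J'
  | _, _ => [::]
  end.

Lemma mask_iota1 (u : bitseq) n : mask u (iota 1 n) = map S (mask u (iota 0 n)).
Proof. by rewrite (iotaDl 1 0) map_mask. Qed.

Lemma trues_cons b u :
  trues (b :: u) = (if b then [:: 0%N] else [::]) ++ map S (trues u).
Proof. by rewrite /trues; case: b => /=; rewrite mask_iota1. Qed.

Lemma falses_cons b u :
  falses (b :: u) = (if b then [::] else [:: 0%N]) ++ map S (falses u).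
Proof. by rewrite /falses; case: b => /=; rewrite mask_iota1. Qed.

Section Words.
Context (R : comNzRingType) (e1 e2 q : R).
Implicit Types (al be : R) (w J v : bitseq).

Local Notation X al := (wtX al e1 q).
Local Notation Y be := (wtY be e2 q).

(* The false letters of [v] are matched in order with the letters of the erased
   word; those matched with a marked element are the indices c_l. *)
Definition word_weight al be w J v : R :=
  (\prod_(i <- trues w) X al i) * (\prod_(i <- trues v) Y be i)
  * (\prod_(j <- trues J) q ^+ (size J - j.+1))
  * \prod_(c <- mask (erase w J) (falses v)) (q ^+ (size v - c) * Y be c).

Lemma prod_trues_X al b w :
  \prod_(i <- trues (b :: w)) X al i =
  (if b then al else 1) * \prod_(i <- trues w) X (X al 1) i.
Proof.
rewrite trues_cons big_cat big_map; congr (_ * _).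
  by case: b; rewrite ?big_seq1 ?big_nil ?wtX0.
by apply: eq_bigr => i _; rewrite wtX_shift.
Qed.

Lemma prod_trues_Y be b v :
  \prod_(i <- trues (b :: v)) Y be i =
  (if b then be else 1) * \prod_(i <- trues v) Y (Y be 1) i.
Proof.
rewrite trues_cons big_cat big_map; congr (_ * _).
  by case: b; rewrite ?big_seq1 ?big_nil ?wtY0.
by apply: eq_bigr => i _; rewrite wtY_shift.
Qed.

Lemma prod_trues_exp b J :
  \prod_(j <- trues (b :: J)) q ^+ (size (b :: J) - j.+1) =
  (if b then q ^+ size J else 1) * \prod_(j <- trues J) q ^+ (size J - j.+1).
Proof.
rewrite trues_cons big_cat big_map; congr (_ * _).
by case: b; rewrite ?big_seq1 ?big_nil //= subSS subn0.
Qed.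

(** Dropping the first letter lowers both the length of [v] and each index [c] by one, so the
    exponents of [q] survive and only [be] shifts. *)
Lemma prod_mask_Y be b v z :
  \prod_(c <- mask z (map S (falses v))) (q ^+ (size (b :: v) - c) * Y be c) =
  \prod_(c <- mask z (falses v)) (q ^+ (size v - c) * Y (Y be 1) c).
Proof.
by rewrite -map_mask big_map; apply: eq_bigr => c _; rewrite wtY_shift.
Qed.

Lemma word_weight_trueB al be w J v :
  word_weight al be w J (true :: v) = be * word_weight al (Y be 1) w J v.
Proof.
by rewrite /word_weight prod_trues_Y falses_cons cat0s prod_mask_Y; ring.
Qed.

Lemma word_weight_unmarked al be w J v :
  word_weight al be (true :: w) (false :: J) v =
  al * word_weight (X al 1) be w J v.
Proof. by rewrite /word_weight prod_trues_X prod_trues_exp /=; ring. Qed.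

(** The marked first element is matched with the first false letter of [v], so $c_1 = 0$; the power
    of [q] joins its contributions from [J] and from [v]. *)
Lemma word_weight_marked al be w J v :
  word_weight al be (true :: w) (true :: J) (false :: v) =
  q ^+ (size J + (size v).+1) * (al * be)
  * word_weight (X al 1) (Y be 1) w J v.
Proof.
rewrite /word_weight prod_trues_X prod_trues_Y prod_trues_exp falses_cons.
by rewrite big_cons prod_mask_Y wtY0 subn0 exprD /=; ring.
Qed.

Lemma word_weight_falses al be w J v :
  word_weight al be (false :: w) J (false :: v) =
  word_weight (X al 1) (Y be 1) w J v.
Proof.
rewrite /word_weight prod_trues_X prod_trues_Y falses_cons /=.
by rewrite -(prod_mask_Y be false) !mul1r.
Qed.

(** * Recurrence for the sums of word weights *)

Definition word_sum n a b al be : R :=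
  \sum_(w <- bitseqs (n + a) | count id w == a)
    \sum_(J <- bitseqs a)
      \sum_(v <- bitseqs (n + b) | (count id J + count id v == b)%N)
        word_weight al be w J v.

(** The part of the sum where the second word begins with [false], for $n+b>0$. Removing an unmarked
    element of $A$ leaves that word untouched, so the recurrence can stay within this part. *)
Definition word_sum_false n a b al be : R :=
  \sum_(w <- bitseqs (n + a) | count id w == a)
    \sum_(J <- bitseqs a)
      \sum_(v <- bitseqs (n + b).-1 | (count id J + count id v == b)%N)
        word_weight al be w J (false :: v).

Lemma word_sum_splitB n a b al be : (0 < n + b)%N ->
  word_sum n a b al be =
  (if b is b'.+1 then be * word_sum n a b' al (Y be 1) else 0)
  + word_sum_false n a b al be.
Proof.
move=> nb0; have -> : (if b is b'.+1 then be * word_sum n a b' al (Y be 1) else 0)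
   = \sum_(w <- bitseqs (n + a) | count id w == a) \sum_(J <- bitseqs a)
      \sum_(v <- bitseqs (n + b).-1 | (count id J + (count id v).+1 == b)%N)
        word_weight al be w J (true :: v).
  case: b nb0 => [|b] nb0.
    rewrite big1 // => w _; rewrite big1 // => J _; rewrite big1 // => v.
    by rewrite addnS.
  rewrite /word_sum mulr_sumr; apply: eq_bigr => w _.
  rewrite mulr_sumr; apply: eq_bigr => J _.
  rewrite mulr_sumr addnS /=; apply: eq_big => [v | v _]; first by rewrite addnS.
  by rewrite word_weight_trueB.
rewrite -big_split; apply: eq_bigr => w _.
rewrite -big_split; apply: eq_bigr => J _.
by rewrite -{1}(prednK nb0) big_bitseqsS.
Qed.

(** The first letter of [w] decides: a false letter is removed together with that of [v], an
    unmarked element is removed alone, and a marked element consumes the false letter of [v]. *)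
Lemma word_sum_false_rec n a b al be : (0 < n + b)%N ->
  word_sum_false n a b al be =
  (if n is n'.+1 then word_sum n' a b (X al 1) (Y be 1) else 0)
  + (if a is a'.+1 then
       al * word_sum_false n a' b (X al 1) be
       + (if b is b'.+1 then
            q ^+ (n + a' + b) * (al * be) * word_sum n a' b' (X al 1) (Y be 1)
          else 0)
     else 0).
Proof.
move=> nb0; rewrite {1}/word_sum_false.
case: (posnP (n + a)) => [/eqP|na0].
  rewrite addn_eq0 => /andP[/eqP n0 /eqP a0]; subst n a.
  rewrite big1 ?addr0 // => w _; rewrite big_seq1.
  apply: big_bitseqs_eq0 => v; move: (count_size id v) nb0 => /=; lia.
rewrite big_bitseqs_words // addrC; congr (_ + _).
  case: n nb0 {na0} => // n _; rewrite /word_sum.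
  apply: eq_bigr => w _; apply: eq_bigr => J _; apply: eq_bigr => v _.
  by rewrite word_weight_falses.
case: a {na0} => // a.
rewrite addrC mulr_sumr.
have -> : (if b is b'.+1 then
            q ^+ (n + a + b) * (al * be) * word_sum n a b' (X al 1) (Y be 1)
          else 0) = \sum_(w <- bitseqs (n + a) | count id w == a)
    \sum_(J <- bitseqs a)
      \sum_(v <- bitseqs (n + b).-1 | ((count id J).+1 + count id v == b)%N)
        word_weight al be (true :: w) (true :: J) (false :: v).
  case: b nb0 => [|b] nb0.
    by rewrite big1 // => w _; rewrite big1 // => J _; rewrite big1.
  rewrite /word_sum mulr_sumr; apply: eq_bigr => w _.
  rewrite mulr_sumr; apply: eq_big_seq => J.
  rewrite mem_bitseqs => /eqP Ja.
  have -> : (n + b.+1).-1 = (n + b)%N by rewrite addnS.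
  rewrite mulr_sumr [LHS]big_seq_cond [RHS]big_seq_cond.
  apply: eq_big => [v | v]; first by rewrite addSn eqSS.
  rewrite mem_bitseqs => /andP[/eqP vb _].
  by rewrite word_weight_marked Ja vb; congr (_ ^+ _ * _ * _); lia.
rewrite -[RHS]big_split; apply: eq_bigr => w _.
rewrite /= big_cat !big_map; congr (_ + _).
rewrite mulr_sumr; apply: eq_bigr => J _; rewrite mulr_sumr.
by apply: eq_bigr => v _; rewrite word_weight_unmarked.
Qed.

Lemma word_sum_rec n a b al be : (0 < n + a + b)%N ->
  word_sum n a b al be =
  (if n is n'.+1 then word_sum n' a b (X al 1) (Y be 1) else 0)
  + (if a is a'.+1 then al * word_sum n a' b (X al 1) be else 0)
  + (if b is b'.+1 then be * word_sum n a b' al (Y be 1) else 0)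
  + (if a is a'.+1 then if b is b'.+1 then
       (q ^+ (n + a' + b) - 1) * (al * be) * word_sum n a' b' (X al 1) (Y be 1)
     else 0 else 0).
Proof.
(* When $n+b=0$ the word [v] is empty and every element of $A$ is unmarked, so only the term in [al]
   survives. *)
case: (posnP (n + b)) => [/eqP|nb0 _].
  rewrite addn_eq0 => /andP[/eqP -> /eqP ->]; case: a => // a _.
  rewrite {1}/word_sum big_bitseqs_words // !addr0 add0r mulr_sumr.
  apply: eq_bigr => w _; rewrite mulr_sumr /= big_cat !big_map.
  rewrite big1 => [|J _]; last by rewrite big_pred0.
  rewrite /= add0r.
  apply: eq_bigr => J _; rewrite mulr_sumr.
  by apply: eq_bigr => v _; rewrite word_weight_unmarked.
rewrite word_sum_splitB // word_sum_false_rec //.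
case: a => [|a]; first by rewrite !addr0 addrC.
(* The [word_sum_false] left by an unmarked element is a full sum minus the part where [v] begins
   with [true]; this is the source of the $-1$. *)
rewrite (word_sum_splitB _ (X al 1)) //.
by case: b nb0 => [|b] _; ring.
Qed.

Lemma word_sum0 al be : word_sum 0 0 0 al be = 1.
Proof. 
rewrite /word_sum /word_weight /trues /falses /=.
by do 3 rewrite ?(big_cons, big_nil) /=; rewrite !mulr1 !addr0. Qed.

End Words.

(** * Coefficients *)

Section Coefficients.
Context (R : comNzRingType) (e1 e2 q : R).
Implicit Types al be : R.

Local Notation X al := (wtX al e1 q).
Local Notation Y be := (wtY be e2 q).
Local Notation p al be := (asc_poly al be e1 e2 q).
Local Notation W n a b al be := (word_sum e1 e2 q n a b al be).

Definition word_total n k al be : R := \sum_(a < k.+1) W n a (k - a) al be.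

Lemma word_total_rec n k al be : (0 < n + k)%N ->
  word_total n k al be =
  (if n is n'.+1 then word_total n' k (X al 1) (Y be 1) else 0)
  + (if k is k'.+1 then
       al * word_total n k' (X al 1) be + be * word_total n k' al (Y be 1)
     else 0)
  + (if k is k'.+2 then
       (q ^+ (n + k').+1 - 1) * (al * be) * word_total n k' (X al 1) (Y be 1)
     else 0).
Proof.
move=> nk0; rewrite {1}/word_total.
rewrite (eq_bigr (fun a : 'I_k.+1 =>
    (if n is n'.+1 then W n' a (k - a) (X al 1) (Y be 1) else 0)
  + (if nat_of_ord a is a'.+1 then al * W n a' (k - a) (X al 1) be else 0)
  + (if (k - a)%N is b'.+1 then be * W n a b' al (Y be 1) else 0)
  + (if nat_of_ord a is a'.+1 then if (k - a)%N is b'.+1 then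
       (q ^+ (n + a' + (k - a)) - 1) * (al * be) * W n a' b' (X al 1) (Y be 1)
     else 0 else 0))); last first.
  move=> a _; rewrite word_sum_rec; last by have := ltn_ord a; lia.
  by [].
rewrite !big_split /= -!addrA; congr (_ + _).
  by case: n {nk0} => [|n] //; rewrite big1.
case: k nk0 => [|k] _.
  by rewrite !big_ord1 /= !addr0.
rewrite addrA; congr (_ + _).
  congr (_ + _).
    rewrite big_ord_recl add0r mulr_sumr.
    by apply: eq_bigr => a _; rewrite /= subSS.
  rewrite big_ord_recr /= subnn addr0 mulr_sumr.
  by apply: eq_bigr => a _; rewrite subSn // -ltnS.
(* The product term requires both $a$ and $b$ positive, so its first and last summands vanish. *)
rewrite big_ord_recl add0r /= big_ord_recr /= subnn addr0.
case: k => [|k]; first by rewrite big_ord0.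
rewrite mulr_sumr; apply: eq_bigr => a _.
have ak : (a <= k)%N by rewrite -ltnS.
rewrite /bump /= subSS subSn //; congr ((_ ^+ _ - _) * _ * _); lia.
Qed.

(* Abstracting the polynomials keeps [coefB] from unfolding the fixpoint. *)
Lemma coef_asc_poly_rec al be n i :
  (p al be n.+2)`_i =
    (if i is j.+1 then (p (X al 1) (Y be 1) n.+1)`_j else 0)
    + al * (p (X al 1) be n.+1)`_i + be * (p al (Y be 1) n.+1)`_i
    - (1 - q ^+ n.+1) * (al * be) * (p (X al 1) (Y be 1) n)`_i.
Proof.
rewrite asc_poly_rec.
move: (p _ _ n.+1) (p (X al 1) be n.+1) (p al _ n.+1) (p _ _ n) => P1 P2 P3 P4.
by rewrite !(coefB, coefD, coefCM, coefXM); case: i.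
Qed.

(** Provides the zero terms of the coefficient recurrence when $k$ is too small. *)
Lemma coef_asc_poly_gt al be N n : (N < n)%N -> (p al be N)`_n = 0.
Proof.
elim/ltn_ind: N al be n => -[|[|N]] IH al be n Nn.
- by rewrite asc_poly0 coef1; case: n Nn.
- by rewrite asc_poly1 coefD coefX coefC; case: n Nn => [|[|n]] //; rewrite addr0.
rewrite coef_asc_poly_rec !(IH _ _ _ _ n) //; try lia.
by case: n Nn => // n Nn; rewrite IH //; ring.
Qed.

Lemma coef_asc_poly al be n k : (p al be (n + k))`_n = word_total n k al be.
Proof.
(* The induction is on the degree, with [al] and [be] free because the recurrence shifts them. *)
move: {2}(n + k)%N (erefl (n + k)%N) => N.
elim/ltn_ind: N al be n k => N IH al be n k nkN.
case: N => [|N] in IH nkN *.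
  move: nkN; case: n k => [|n] [|k] // _.
  by rewrite /word_total big_ord1 word_sum0 coef1.
rewrite word_total_rec; last by rewrite nkN.
have IHX n' : n = n'.+1 ->
    (p (X al 1) (Y be 1) N)`_n' = word_total n' k (X al 1) (Y be 1).
  move=> nE; have NE : N = (n' + k)%N by lia.
  by rewrite {1}NE (IH N) -?NE.
have IHk al' be' :
    (p al' be' N)`_n = if k is k'.+1 then word_total n k' al' be' else 0.
  case: k nkN {IHX} => [|k] nkN; first by rewrite coef_asc_poly_gt //; lia.
  have NE : N = (n + k)%N by lia.
  by rewrite NE (IH N) -?NE.
(* The coefficient recurrence is extended down to degree 1, where its last term is absent. *)
have -> : (p al be (n + k))`_n =
    (if n is n'.+1 then (p (X al 1) (Y be 1) N)`_n' else 0)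
    + (al * (p (X al 1) be N)`_n + be * (p al (Y be 1) N)`_n)
    + (if N is N'.+1 then
         (q ^+ N - 1) * (al * be) * (p (X al 1) (Y be 1) N')`_n else 0).
  rewrite nkN; case: N {IH nkN IHX IHk} => [|N].
    rewrite asc_poly1 !asc_poly0 coefD coefX coefC !coef1.
    by case: n => [|[|n]]; rewrite ?coef1 /=; ring.
  by rewrite coef_asc_poly_rec; ring.
rewrite !IHk; congr (_ + _ + _).
- by case: n nkN IHX {IHk} => // n _ ->.
- by case: k {nkN IHX IHk} => // ; rewrite !mulr0 addr0.
case: k N IH nkN {IHX IHk} => [|[|k]] [|N] IH nkN //; try lia.
- by rewrite coef_asc_poly_gt ?mulr0 //; lia.
- by rewrite coef_asc_poly_gt ?mulr0 //; lia.
have NE : N = (n + k)%N by lia.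
by rewrite {2}NE (IH N) -?NE.
Qed.

End Coefficients.

(** * Sets as words *)

Lemma big_bitseqs_cat (V : nmodType) m k (P : pred bitseq) (F : bitseq -> V) :
  \sum_(u <- bitseqs (m + k) | P u) F u =
  \sum_(v <- bitseqs m) \sum_(J <- bitseqs k | P (v ++ J)) F (v ++ J).
Proof.
elim: m P F => [|m IH] P F; first by rewrite big_seq1.
by rewrite addSn big_bitseqsS !IH [RHS]big_bitseqsS.
Qed.

(** Needed because the index $j$ stands for $n+b+a-j$: markings read the top letters of $B$
    downwards. *)
Lemma big_bitseqs_rev (V : nmodType) m (P : pred bitseq) (F : bitseq -> V) :
  \sum_(u <- bitseqs m | P u) F u =
  \sum_(u <- bitseqs m | P (rev u)) F (rev u).
Proof.
rewrite -[RHS](big_map rev P F); apply: perm_big.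
have revI : injective (@rev bool) := inv_inj revK.
apply: uniq_perm; rewrite ?(map_inj_uniq revI) ?bitseqs_uniq // => u.
by rewrite -[u in RHS]revK (mem_map revI) !mem_bitseqs size_rev.
Qed.

Lemma truesE u : trues u = [seq i <- iota 0 (size u) | nth false u i].
Proof. by rewrite filter_mask -/(mkseq _ _) mkseq_nth. Qed.

Lemma falsesE u : falses u = [seq i <- iota 0 (size u) | ~~ nth false u i].
Proof.
by rewrite filter_mask (map_comp negb (nth false u)) -/(mkseq _ _) mkseq_nth.
Qed.

Lemma mem_trues u i : (i \in trues u) = nth false u i.
Proof.
rewrite truesE mem_filter mem_iota /= add0n.
by case: ltnP => [|/(nth_default false) ->]; rewrite ?andbT.
Qed.

Lemma size_trues u : size (trues u) = count id u.
Proof. by rewrite size_mask // size_iota. Qed.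

Lemma size_falses u : size (falses u) = (size u - count id u)%N.
Proof.
rewrite size_mask ?size_map ?size_iota // count_map -(count_predC id u) addKn.
exact: eq_count.
Qed.

Lemma trues_cat u v : trues (u ++ v) = trues u ++ map (addn (size u)) (trues v).
Proof.
by rewrite /trues size_cat iotaD mask_cat ?size_iota // add0n map_mask -iotaDl addn0.
Qed.

(** Ensures that the subtraction in the entries of $\mu$ is not truncated. *)
Lemma leq_nth_trues u j : (j < count id u)%N -> (j <= nth 0%N (trues u) j)%N.
Proof.
elim: u j => //= b u IH j; rewrite trues_cons; case: b => /= [|jc].
  case: j => [|j] //; rewrite add1n ltnS => jc.
  by rewrite /= (nth_map 0%N) ?size_trues // ltnS IH.
by rewrite (nth_map 0%N) ?size_trues // ltnW // ltnS IH.
Qed.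

Lemma nth_trues_lt u l : (l < count id u)%N -> (nth 0%N (trues u) l < size u)%N.
Proof.
move=> lc; have := mem_nth 0%N (_ : (l < size (trues u))%N).
by rewrite size_trues truesE mem_filter mem_iota => /(_ lc) /andP[].
Qed.

(** For $|A|=a$ this length is $n$ plus the number of marks, which is also the number of false
    letters of [v]: the matching in [word_weight] is complete. *)
Lemma size_erase w J : count id w = size J ->
  size (erase w J) = (size w - count id w + count id J)%N.
Proof.
elim: w J => [|[] w IH] J /=; first by case: J.
  by case: J => [|[] J] // [wJ]; rewrite /= IH //; lia.
by rewrite add0n => wJ; rewrite IH //; have := count_size id w; lia.
Qed.

(* Counting from 0, the l-th marked element of A is its j-th element, where j is
   the l-th marked position; in the erased word mu_j letters false and l marked
   elements precede it. *)
Lemma trues_erase w J : count id w = size J ->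
  trues (erase w J) =
  mkseq (fun l => let j := nth 0 (trues J) l in nth 0 (trues w) j - j + l)%N
    (count id J).
Proof.
elim: w J => [|b w IH] J /=; first by case: J.
case: b => [|/=]; last first.
  rewrite add0n => wJ; rewrite !trues_cons IH // /mkseq -map_comp /=.
  apply/eq_in_map => l; rewrite mem_iota => /= lJ.
  have jw : (nth 0%N (trues J) l < count id w)%N by rewrite wJ nth_trues_lt.
  rewrite (nth_map 0%N) ?size_trues //.
  by have := leq_nth_trues jw; lia.
case: J => [|c J]; rewrite //= add1n => -[wJ].
(* A leading [true] raises an element and its rank by one each, so the entry of $\mu$ is
   unchanged. *)
have step l : (l < count id J)%N ->
    nth 0%N (trues (true :: w)) (nth 0%N (trues J) l).+1 =
    (nth 0%N (trues w) (nth 0%N (trues J) l)).+1.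
  move=> lJ; rewrite trues_cons /= (nth_map 0%N) // size_trues wJ.
  exact: nth_trues_lt.
case: c; rewrite (trues_cons _ J) /=.
  rewrite add1n trues_cons IH // /mkseq /= (iotaDl 1 0) -!map_comp.
  congr (_ :: _).
  apply/eq_in_map => l; rewrite mem_iota => /= lJ.
  by rewrite add1n /= (nth_map 0%N) ?size_trues // step // subSS addnS.
rewrite add0n IH //; apply/eq_in_map => l; rewrite mem_iota => /= lJ.
by rewrite (nth_map 0%N) ?size_trues // step.
Qed.

Lemma mask_trues (T : Type) (x : T) z (s : seq T) :
  size z = size s -> mask z s = [seq nth x s i | i <- trues z].
Proof. by move=> zs; rewrite map_mask zs -/(mkseq _ _) mkseq_nth. Qed.

(** * Subsets and their indicator words *)

Section Indicator.
Context (m : nat).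
Implicit Types (A : {set 'I_m}) (u : bitseq).

Definition indicator A : bitseq := [seq i \in A | i <- enum 'I_m].

Lemma size_indicator A : size (indicator A) = m.
Proof. by rewrite size_map size_enum_ord. Qed.

Lemma elts_indicator A : elts A = trues (indicator A).
Proof.
rewrite /elts {1}/enum_mem -enumT filter_mask map_mask val_enum_ord.
by rewrite /trues size_indicator.
Qed.

Lemma count_indicator A : count id (indicator A) = #|A|.
Proof. by rewrite -size_trues -elts_indicator size_map cardE. Qed.

Lemma nth_indicator A (i : 'I_m) : nth false (indicator A) i = (i \in A).
Proof. by rewrite (nth_map i) ?size_enum_ord // nth_ord_enum. Qed.

Lemma indicator_inj : injective indicator.
Proof. by move=> A B AB; apply/setP => i; rewrite -!nth_indicator AB. Qed.

Lemma big_indicator (V : nmodType) (P : pred bitseq) (F : bitseq -> V) :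
  \sum_(A : {set 'I_m} | P (indicator A)) F (indicator A) =
  \sum_(u <- bitseqs m | P u) F u.
Proof.
rewrite -(big_map indicator P F); apply: perm_big.
apply: uniq_perm; rewrite ?(map_inj_uniq indicator_inj) ?index_enum_uniq //.
  exact: bitseqs_uniq.
move=> u; rewrite mem_bitseqs; apply/mapP/eqP => [[A _ ->]|um].
  exact: size_indicator.
exists [set i : 'I_m | nth false u i]; first exact: mem_index_enum.
apply: (@eq_from_nth _ false) => [|i]; rewrite um ?size_indicator // => im.
by rewrite (nth_indicator _ (Ordinal im)) inE.
Qed.

End Indicator.

(** * Comparison of the set weight with the word weight *)

Lemma kth_missing_falses m (B : {set 'I_m}) v t k : indicator B = v ++ t ->
  (k < size (falses v))%N -> kth_missing B k.+1 = nth 0%N (falses v) k.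
Proof.
move=> Bvt kv; rewrite /kth_missing elts_indicator Bvt subSS subn0.
have vm : (size v <= m)%N by rewrite -(size_indicator B) Bvt size_cat leq_addr.
have -> : (m + k.+1 = size v + (m + k.+1 - size v))%N by lia.
rewrite iotaD filter_cat add0n nth_cat.
have -> : [seq i <- iota 0 (size v) | i \notin trues (v ++ t)] = falses v.
  rewrite falsesE; apply: eq_in_filter => i; rewrite mem_iota => /= iv.
  by rewrite mem_trues nth_cat iv.
by rewrite kv.
Qed.

(** The number $n+b+a-j$ is letter $a-j$ of [rev J], hence letter $j-1$ of [J], counting from 0. *)
Lemma top_indices_trues n a b (B : {set 'I_(n + a + b)}) v J :
  indicator B = v ++ rev J -> size v = (n + b)%N -> size J = a ->
  top_indices B = map S (trues J).
Proof.
move=> BE vE JE; rewrite /top_indices elts_indicator BE (iotaDl 1 0) filter_map.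
rewrite (truesE J) JE; congr map; apply: eq_in_filter => j; rewrite mem_iota => /= ja.
rewrite add1n mem_trues nth_cat vE ifN; last by lia.
rewrite nth_rev ?JE; last by lia.
by congr (nth _ _); lia.
Qed.

Lemma weight_indicator (R : comNzRingType) (al be e1 e2 q : R) n a b
    (A : {set 'I_(n + a)}) (B : {set 'I_(n + a + b)}) v J :
  #|A| = a -> #|B| = b ->
  indicator B = v ++ rev J -> size v = (n + b)%N -> size J = a ->
  weight al be e1 e2 q A B = word_weight e1 e2 q al be (indicator A) J v.
Proof.
move=> Aa Bb BE vE JE; rewrite /weight /word_weight -!mulrA.
have wJ : count id (indicator A) = size J by rewrite count_indicator Aa.
have cJv : (count id J + count id v = b)%N.
  by rewrite -Bb -count_indicator BE count_cat count_rev addnC.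
congr (_ * _).
  by rewrite -elts_indicator big_map big_enum.
congr (_ * _).
  have -> : \prod_(i in B | (i < n + b)%N) wtY be e2 q i =
      \prod_(i <- elts B | (i < n + b)%N) wtY be e2 q i.
    by rewrite big_map big_enum_cond.
  rewrite elts_indicator BE trues_cat big_cat /= big_map [X in _ * X]big1 ?mulr1.
    rewrite big_seq_cond [RHS]big_seq; apply: eq_bigl => i.
    rewrite truesE mem_filter mem_iota vE /= add0n.
    by case: (i < n + b)%N; rewrite ?andbF ?andbT.
  by move=> i; rewrite vE; lia.
have zE : size (erase (indicator A) J) = size (falses v).
  rewrite size_erase // size_falses size_indicator count_indicator Aa vE.
  by have := count_size id v; lia.
rewrite (top_indices_trues BE vE JE) (mask_trues 0%N zE) trues_erase //.
rewrite !big_map big_add1 size_map size_trues /=.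
rewrite [X in _ = X * _](big_nth 0%N) size_trues.
have <- : index_iota 0 (count id J) = iota 0 (count id J).
  by rewrite /index_iota subn0.
rewrite -big_split /=.
rewrite [LHS]big_nat [RHS]big_nat; apply: eq_bigr => l /andP[_ lJ].
rewrite subSS subn0 (nth_map 0%N) ?size_trues // subSS subn0.
set j := nth 0%N (trues J) l.
have ja : (j < a)%N by rewrite -JE nth_trues_lt.
rewrite nth_mkseq ?Aa // elts_indicator addnS.
set c := (_ - j + l)%N.
(* By [trues_erase], [c] is a position in the erased word, which has as many letters as [v] has
   false ones; hence $c_l$ lies below $n+b$. *)
have cv : (c < size (falses v))%N.
  have : c \in trues (erase (indicator A) J).
    by rewrite trues_erase //; apply/mapP; exists l; rewrite ?mem_iota.
  by rewrite truesE mem_filter mem_iota zE => /andP[_ /andP[]].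
(* The exponent $n+b+a-j_l-c_l$ is split as $(a-j_l)+(n+b-c_l)$. *)
rewrite (kth_missing_falses BE cv) mulrA -exprD; congr (q ^+ _ * _).
have : nth 0%N (falses v) c \in falses v by apply: mem_nth.
by rewrite {2}falsesE mem_filter mem_iota => /andP[_ /andP[_]]; rewrite JE vE; lia.
Qed.

Lemma sum_weight (R : comNzRingType) (al be e1 e2 q : R) n a b :
  \sum_(A : {set 'I_(n + a)} | #|A| == a)
    \sum_(B : {set 'I_(n + a + b)} | #|B| == b) weight al be e1 e2 q A B =
  word_sum e1 e2 q n a b al be.
Proof.
rewrite /word_sum -big_indicator; apply: eq_big => [A | A /eqP Aa].
  by rewrite count_indicator.
(* The word of $B$ is cut after $n+b$ letters; the remaining $a$ letters, reversed, form the
   marking. *)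
pose F u := word_weight e1 e2 q al be (indicator A)
  (rev (drop (n + b) u)) (take (n + b) u).
transitivity (\sum_(B : {set 'I_(n + a + b)} | count id (indicator B) == b)
    F (indicator B)).
  apply: eq_big => [B | B /eqP Bb]; first by rewrite count_indicator.
  apply: weight_indicator => //; rewrite ?revK ?cat_take_drop //.
    by rewrite size_takel // size_indicator; lia.
  by rewrite size_rev size_drop size_indicator; lia.
rewrite (big_indicator _ (fun u => count id u == b)) addnAC big_bitseqs_cat.
rewrite (exchange_big_dep xpredT) //= [LHS]big_bitseqs_rev; apply: eq_bigr => J _.
rewrite [LHS]big_seq_cond [RHS]big_seq_cond; apply: eq_big => [v | v].
  by rewrite count_cat count_rev (addnC (count id v)).
rewrite mem_bitseqs => /andP[/eqP vE _].
by rewrite /F take_size_cat // drop_size_cat // revK.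
Qed.

Theorem theorem2p8 (R : comNzRingType) (al be e1 e2 q : R) (n k : nat) :
  (asc_poly al be e1 e2 q (n + k))`_n =
  \sum_(a < k.+1) \sum_(b < k.+1 | (a + b)%N == k)
    \sum_(A : {set 'I_(n + a)} | #|A| == a)
      \sum_(B : {set 'I_(n + a + b)} | #|B| == b)
        weight al be e1 e2 q A B.
Proof.
rewrite coef_asc_poly; apply: eq_bigr => a _.
have ak : (a <= k)%N by rewrite -ltnS.
have bk : (k - a < k.+1)%N by lia.
rewrite (big_pred1 (Ordinal bk)) => [|b]; first by rewrite sum_weight.
by rewrite /= -val_eqE /=; lia.
Qed.
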